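(* For any planar graph $G$, if $\mathcal{B}=\{N[v]\mid v\in V(G)\}$, then NCTD$(\mathcal{B})\le 5$.
   Context: $N[v]$ is the closed neighborhood of $v$. A teaching map for $\mathcal{B}$ assigns to each $B\in\mathcal{B}$ a set $T(B)\subseteq V(G)$ (examples labeled by membership in $B$). A vertex $w$ distinguishes $B,B'$ if $w$ lies in exactly one of them. $T$ is non-clashing if for all distinct $B,B'\in\mathcal{B}$ some $w\in T(B)\cup T(B')$ distinguishes them; its size is $\max_{B\in\mathcal{B}}|T(B)|$. NCTD$(\mathcal{B})$ is the minimum size of a non-clashing teaching map for $\mathcal{B}$. *)

(* Defs.v *)
From HB Require Import structures.
From mathcomp Require Import all_boot all_order all_algebra.
From mathcomp Require Import all_classical all_reals all_analysis.
From mathcomp Require Import Rstruct Rstruct_topology.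
From Stdlib Require Rdefinitions.
Import numFieldNormedType.Exports.
Local Open Scope classical_set_scope.
Local Open Scope ring_scope.

Set Implicit Arguments.
Unset Strict Implicit.
Unset Printing Implicit Defensive.

Definition simple_graph (V : finType) (e : rel V) : Prop :=
  symmetric e /\ irreflexive e.

Definition plane := (Rdefinitions.R * Rdefinitions.R)%type.

(* Planarity: a drawing in the plane.  Vertices go to distinct points; each
   edge {x,y} is drawn as an arc, i.e. a continuous injective map from [0,1]
   joining p x to p y; the interior of an arc contains no vertex point, and
   the interiors of arcs of different edges are disjoint.  (An arc is given
   for every ordered adjacent pair; arcs of (x,y) and (y,x) represent the
   same edge and are not required to be disjoint.) *)
Definition planar (V : finType) (e : rel V) : Prop :=
  exists (p : V -> plane) (arc : V -> V -> Rdefinitions.R -> plane),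
    [/\ injective p,
        (forall x y, e x y ->
           [/\ {within `[(0:Rdefinitions.R), 1], continuous (arc x y)},
               set_inj `[0, 1] (arc x y),
               arc x y 0 = p x & arc x y 1 = p y]),
        (forall x y z t, e x y -> (0 < t < 1) -> arc x y t <> p z) &
        (forall x y x' y' s t, e x y -> e x' y' ->
           (0 < s < 1) -> (0 < t < 1) -> arc x y s = arc x' y' t ->
           ((x == x') && (y == y')) || ((x == y') && (y == x')))].

Definition closed_nbhd (V : finType) (e : rel V) (v : V) : {set V} :=
  [set u | (u == v) || e v u].

Definition ball_family (V : finType) (e : rel V) : {set {set V}} :=
  [set closed_nbhd e v | v in V].

(* Teaching maps: functions assigning to each concept B a set T(B) of
   vertices (only the values on the concept class matter). *)
Definition teaching_map (V : finType) := {ffun {set V} -> {set V}}.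

Definition distinguishes (V : finType) (w : V) (B B' : {set V}) : bool :=
  (w \in B) != (w \in B').

Definition non_clashing (V : finType) (C : {set {set V}}) (T : teaching_map V)
  : bool :=
  [forall B in C, forall B' in C,
     (B != B') ==> [exists w in T B :|: T B', distinguishes w B B']].

Definition tm_size (V : finType) (C : {set {set V}}) (T : teaching_map V)
  : nat := \max_(B in C) #|T B|.

(* NCTD(C): minimum size of a non-clashing teaching map.  The map
   B |-> V is always non-clashing and has size <= #|V|, so the default
   value #|V| of the minimum is never smaller than the true minimum. *)
Definition NCTD (V : finType) (C : {set {set V}}) : nat :=
  \big[minn/#|V|]_(T : teaching_map V | non_clashing C T) tm_size C T.

(* Main.v *)
(* Give N[v] the teaching set consisting of v and, for each out-neighbour u of v
   in a fixed orientation of G, one vertex separating N[v] from N[u]: two balls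
   with non-adjacent centers are separated by their centers, and an edge between
   centers is served by its tail.  So it suffices to orient G with out-degrees
   at most 4, which is possible as soon as every subgraph on n > 0 vertices has
   fewer than 4n edges.  A subgraph with at least 4n edges has a K5 minor: as long
   as some edge lies in few triangles contract it, otherwise recurse in the
   neighbourhood of a vertex.  Finally a drawing of G excludes a K5 minor by a
   discrete form of the van Kampen obstruction: a minor model gives five points
   joined by chains of close points such that chains of independent edges are
   far apart; counting mod 2 how often the difference vectors of two such chains
   cross the negative x-axis, around the boundary of the product of the chains,
   yields 15 equations over F_2 whose sum is 0 = 1.  No general position or Jordan
   curve theorem is needed. *)
Require Import Defs.
From mathcomp Require Import all_boot all_order all_algebra.
From mathcomp Require Import zify lra.

Set Implicit Arguments.
Unset Strict Implicit.
Unset Printing Implicit Defensive.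

(** * Dense graphs have clique minors *)

Section Minors.
Variable V : finType.
Implicit Types (r : rel V) (S A B : {set V}) (x y u v : V).

Definition rel_in r A : rel V := [rel x y | [&& x \in A, y \in A & r x y]].

Definition connected_in r A : bool :=
  (A != set0) && [forall x in A, forall y in A, connect (rel_in r A) x y].

Definition linked r A B : bool :=
  [disjoint A & B] && [exists x in A, exists y in B, r x y].

Definition clique_minor r S k : Prop :=
  exists Bs : seq {set V},
    [/\ size Bs = k, all (fun B => B \subset S) Bs, all (connected_in r) Bs
      & pairwise (linked r) Bs].

(* Twice the number of edges inside S. *)
Definition deg_sum r S : nat := \sum_(u in S) \sum_(v in S) r u v.

(** The merged vertex keeps the name [x]. As [y] remains in [V], the contracted graph is read inside
    [S :\ y]. *)
Definition contract r x y : rel V :=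
  [rel u v | [|| r u v, [&& u == x, r y v & v != x]
                       | [&& v == x, r y u & u != x]]].

Definition expand x y A : {set V} := if x \in A then y |: A else A.

Definition common_nbrs r S x y : nat := \sum_(z in S) (r x z && r y z).

Lemma connected_inP r A :
  reflect (A != set0 /\ {in A &, forall x y, connect (rel_in r A) x y})
          (connected_in r A).
Proof.
apply: (iffP andP) => -[A0 cA]; split=> //.
  by move=> x y xA yA; move/forall_inP/(_ x xA)/forall_inP/(_ y yA): cA.
by apply/forall_inP=> x xA; apply/forall_inP=> y yA; apply: cA.
Qed.

Lemma connected_in1 r x : connected_in r [set x].
Proof.
apply/connected_inP; split=> [|a b /set1P-> /set1P->]; last exact: connect0.
by apply/set0Pn; exists x; rewrite inE.
Qed.

Lemma linkedP r A B :
  reflect ([disjoint A & B] /\ exists x y, [/\ x \in A, y \in B & r x y])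
          (linked r A B).
Proof.
apply: (iffP andP) => -[dAB eAB]; split=> //.
  by case/exists_inP: eAB => x xA /exists_inP[y yB rxy]; exists x, y.
by case: eAB => x [y [xA yB rxy]]; apply/exists_inP; exists x => //; apply/exists_inP; exists y.
Qed.

Lemma rel_in_sym r A : symmetric r -> symmetric (rel_in r A).
Proof. by move=> sr x y; rewrite /rel_in /= sr; case: (x \in A); case: (y \in A). Qed.

Lemma contract_sym r x y : symmetric r -> symmetric (contract r x y).
Proof. by by move=> sr u v; rewrite /contract /= sr [X in _ || X]orbC. Qed.

Lemma contract_irr r x y : irreflexive r -> irreflexive (contract r x y).
Proof. by by move=> ir u; rewrite /contract /= ir; case: (u =P x); rewrite ?andbF. Qed.

Lemma mem_expand x y A a : a \in A -> a \in expand x y A.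
Proof. by rewrite /expand; case: ifP => // _ aA; rewrite inE aA orbT. Qed.

Lemma mem_expand_center x y A : x \in A -> y \in expand x y A.
Proof. by rewrite /expand => ->; rewrite setU11. Qed.

(** An edge created at [x] lifts to a path of length two through [y], which [expand] adds whenever
    [x] is present. *)
Lemma contract_connected r x y A : symmetric r -> r x y ->
  connected_in (contract r x y) A -> connected_in r (expand x y A).
Proof.
move=> sr rxy /connected_inP[A0 cA]; apply/connected_inP; split.
  by have /set0Pn[a aA] := A0; apply/set0Pn; exists a; apply: mem_expand.
have cs : connect_sym (rel_in r (expand x y A)).
  by apply: sym_connect_sym; apply: rel_in_sym.
have cxy : x \in A -> connect (rel_in r (expand x y A)) x y.
  by move=> xA; apply: connect1; rewrite /rel_in /= mem_expand // mem_expand_center.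
have sub : {in A &, forall u v, connect (rel_in r (expand x y A)) u v}.
  move=> u v uA vA; move: (cA u v uA vA); apply: connect_sub => a b /=.
  case/and3P=> aA bA /or3P[rab|/and3P[/eqP ax ryb _]|/and3P[/eqP bx rya _]].
  - by apply: connect1; rewrite /rel_in /= !mem_expand.
  - rewrite ax in aA *; apply: connect_trans (cxy aA) _.
    by apply: connect1; rewrite /rel_in /= mem_expand_center // mem_expand.
  - rewrite bx in bA *; rewrite cs; apply: connect_trans (cxy bA) _.
    by apply: connect1; rewrite /rel_in /= mem_expand_center // mem_expand.
have toA u : u \in expand x y A ->
    exists2 a, a \in A & connect (rel_in r (expand x y A)) u a.
  rewrite {1}/expand; case: ifP => [xA|_] uA; last by exists u.
  by case/setU1P: uA => [->|uA]; [exists x; rewrite // cs cxy | exists u].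
move=> u v /toA[a aA ua] /toA[b bA]; rewrite cs => bv.
exact: connect_trans ua (connect_trans (sub a b aA bA) bv).
Qed.

(** Contraction loses the edge [xy] and one edge per common neighbour; the other edges at [y] move
    to [x]. Each lost edge counts twice. *)
Lemma deg_sum_contract r S x y : x \in S -> y \in S -> symmetric r ->
  irreflexive r -> r x y ->
  deg_sum r S <= deg_sum (contract r x y) (S :\ y) + (common_nbrs r S x y).*2 + 2.
Proof.
move=> xS yS sr ir rxy.
have xy : x != y by apply: contraTneq rxy => ->; rewrite ir.
have xS' : x \in S :\ y by rewrite !inE xy.
set S' := S :\ y in xS' *.
have E1 : deg_sum r S = deg_sum r S' + (\sum_(v in S') r y v).*2.
  rewrite /deg_sum (big_setD1 y) //= (big_setD1 y) //= ir add0n.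
  under [X in _ + X]eq_bigr => u _ do rewrite (big_setD1 y) //= sr.
  by rewrite big_split /= -/S' -addnn; lia.
(* These are the neighbours of [y] that are new to [x]. The others are common neighbours or [x]
   itself, whence the [+ 1] in [E2]. *)
pose q v : nat := [&& r y v, ~~ r x v & v != x].
have E2 : \sum_(v in S') r y v <= \sum_(v in S') q v + common_nbrs r S x y + 1.
  have -> : common_nbrs r S x y = \sum_(v in S') (r x v && r y v).
    by rewrite /common_nbrs (big_setD1 y) //= ir andbF add0n.
  rewrite -[1](_ : \sum_(v in S') (v == x) = 1); last first.
    rewrite (big_setD1 x) //= eqxx big1 // => v; rewrite /S' !inE => /andP[/negPf-> _] //.
  rewrite -!big_split /=; apply: leq_sum => v _; rewrite /q.
  by case: (r y v); case: (r x v); case: (v == x).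
have E3 : deg_sum r S' + (\sum_(v in S') q v).*2 <= deg_sum (contract r x y) S'.
  have F1 : \sum_(v in S') q v = \sum_(u in S') \sum_(v in S') (u == x) * q v.
    rewrite [RHS](big_setD1 x) //= [X in _ + X]big1 ?addn0 => [|u]; last first.
      by rewrite /S' !inE => /andP[/negPf-> _]; rewrite big1.
    by under [RHS]eq_bigr => v _ do rewrite eqxx mul1n.
  have F2 : \sum_(v in S') q v = \sum_(u in S') \sum_(v in S') (v == x) * q u.
    by rewrite F1 exchange_big.
  rewrite -addnn {1}F1 F2 /deg_sum -!big_split /=; apply: leq_sum => u _.
  rewrite -!big_split /=; apply: leq_sum => v _; rewrite /q.
  rewrite /contract /=.
  have [->|ux] := eqVneq u x; have [->|vx] := eqVneq v x; rewrite ?eqxx ?ir ?ux ?vx /=.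
  - by rewrite !andbF.
  - by case: (r x v); case: (r y v).
  - by rewrite (sr u x); case: (r x u); case: (r y u).
  - by case: (r u v).
lia.
Qed.

(** The branch sets are disjoint and avoid [y], so at most one of them contains [x] and receives
    [y]. *)
Lemma contract_clique_minor r S x y k : x \in S -> y \in S -> symmetric r ->
  r x y -> clique_minor (contract r x y) (S :\ y) k -> clique_minor r S k.
Proof.
move=> xS yS sr rxy [Bs [sz sub con lnk]].
exists (map (expand x y) Bs); split; first by rewrite size_map.
- rewrite all_map; apply: sub_all sub => B /= /subsetD1P[BS _].
  by rewrite /expand; case: ifP => // _; rewrite subUset sub1set yS.
- rewrite all_map; by apply: sub_all con => B; apply: contract_connected.
rewrite pairwise_map; apply: (sub_in_pairwise _ sub lnk) => A B sA sB.
have {sA}/subsetD1P[_ yA] := sA; have {sB}/subsetD1P[_ yB] := sB.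
case/linkedP => dAB [a [b [aA bB rab]]]; apply/linkedP; split.
  rewrite /expand; case: ifP => xA; case: ifP => xB //.
  - by move: dAB => /disjointFr/(_ xA); rewrite xB.
  - by rewrite -setI_eq0 setIUl setU_eq0 !setI_eq0 dAB disjoints1 yB.
  - by rewrite -setI_eq0 setIUr setU_eq0 !setI_eq0 dAB disjoint_sym disjoints1 yA.
case/or3P: rab => [rab|/and3P[/eqP ax ryb _]|/and3P[/eqP bx rya _]].
- by exists a, b; rewrite !mem_expand.
- by exists y, b; split=> //; [apply: mem_expand_center; rewrite -ax | apply: mem_expand].
- by exists a, y; split; [apply: mem_expand | apply: mem_expand_center; rewrite -bx | rewrite sr].
Qed.

Lemma cone_clique_minor r S x k : x \in S -> irreflexive r ->
  clique_minor r [set z in S | r x z] k -> clique_minor r S k.+1.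
Proof.
move=> xS ir [Bs [sz sub con lnk]]; exists ([set x] :: Bs); split=> /=.
- by rewrite sz.
- rewrite sub1set xS; apply: sub_all sub => B /subset_trans; apply.
  by apply/subsetP => z; rewrite inE => /andP[].
- by rewrite connected_in1.
rewrite lnk andbT; apply/allP => B BBs; apply/linkedP.
have /subsetP sB := allP sub _ BBs.
have /connected_inP[/set0Pn[b bB] _] := allP con _ BBs.
split; last by exists x, b; have := sB _ bB; rewrite !inE => /andP[].
by rewrite disjoints1; apply/negP => /sB; rewrite inE ir andbF.
Qed.

Lemma connected_in_setU r A B : symmetric r -> connected_in r A ->
  connected_in r B -> linked r A B -> connected_in r (A :|: B).
Proof.
move=> sr /connected_inP[A0 cA] /connected_inP[_ cB] /linkedP[_ [a [b [aA bB rab]]]].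
have mono (C : {set V}) : C \subset A :|: B ->
    subrel (connect (rel_in r C)) (connect (rel_in r (A :|: B))).
  move=> /subsetP sC; apply: connect_sub => x y /and3P[xC yC rxy].
  by apply: connect1; rewrite /rel_in /= !sC.
have cs : connect_sym (rel_in r (A :|: B)).
  by apply: sym_connect_sym; apply: rel_in_sym.
have ab : connect (rel_in r (A :|: B)) a b.
  by apply: connect1; rewrite /rel_in /= !inE aA bB orbT.
have to_a x : x \in A :|: B -> connect (rel_in r (A :|: B)) x a.
  case/setUP => [xA|xB]; first exact: mono (subsetUl _ _) _ _ (cA _ _ xA aA).
  by rewrite cs; apply: connect_trans ab (mono _ (subsetUr _ _) _ _ (cB _ _ bB xB)).
apply/connected_inP; split=> [|x y /to_a xa /to_a ya].
  by have /set0Pn[x xA] := A0; apply/set0Pn; exists x; rewrite inE xA.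
by apply: connect_trans xa _; rewrite cs.
Qed.

(** In the step to [k.+1], contracting an edge with fewer than [2 ^ k] common neighbours costs at
    most [2 ^ k.+1], just what the bound drops with one vertex. Without such an edge, the
    neighbourhood of a non-isolated vertex has minimum degree at least [2 ^ k], and the case [k]
    applies to it. *)
Theorem dense_clique_minor k r S : symmetric r -> irreflexive r -> S != set0 ->
  2 ^ k * #|S| <= deg_sum r S -> clique_minor r S k.+2.
Proof.
elim: k r S => [|k IHk] r S sr ir.
  rewrite -card_gt0 mul1n => S0 leD.
  have: deg_sum r S != 0 by lia.
  rewrite sum_nat_eq0 negb_forall_in => /exists_inP[x xS].
  rewrite sum_nat_eq0 negb_forall_in => /exists_inP[y yS]; rewrite eqb0 negbK => rxy.
  exists [:: [set x]; [set y]]; split=> //=; rewrite ?sub1set ?xS ?yS ?connected_in1 //.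
  rewrite !andbT; apply/linkedP; split; last by exists x, y; rewrite !set11.
  by rewrite disjoints1 inE; apply: contraTneq rxy => ->; rewrite ir.
elim: {S}_.+1 {-2}S (ltnSn #|S|) r sr ir => // n IHn S leSn r sr ir S0 leD.
have [/exists_inP[x xS /exists_inP[y yS /andP[rxy few]]]|many] :=
  boolP [exists x in S, exists y in S, r x y && (common_nbrs r S x y < 2 ^ k)].
  have cS := cardsD1 y S; rewrite yS in cS.
  have xy : x != y by apply: contraTneq rxy => ->; rewrite ir.
  apply: (contract_clique_minor xS yS sr rxy); apply: IHn.
  - lia.
  - exact: contract_sym.
  - exact: contract_irr.
  - by apply/set0Pn; exists x; rewrite !inE xy.
  have := deg_sum_contract xS yS sr ir rxy.
  move: leD; rewrite cS expnS mulnDr muln1; lia.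
have Spos : 0 < #|S| by rewrite card_gt0.
have: deg_sum r S != 0.
  have : 0 < 2 ^ k.+1 * #|S| by rewrite muln_gt0 expn_gt0 Spos.
  lia.
rewrite sum_nat_eq0 negb_forall_in => /exists_inP[x xS].
rewrite sum_nat_eq0 negb_forall_in => /exists_inP[y yS]; rewrite eqb0 negbK => rxy.
apply: (cone_clique_minor xS ir); apply: IHk => //.
  by apply/set0Pn; exists y; rewrite inE yS.
rewrite mulnC -sum_nat_const; apply: leq_sum => z; rewrite inE => /andP[zS rxz].
move: many; rewrite negb_exists_in => /forall_inP/(_ x xS).
rewrite negb_exists_in => /forall_inP/(_ z zS); rewrite rxz /= -leqNgt => /leq_trans; apply.
rewrite /common_nbrs [leqRHS](eq_bigl (fun v => (v \in S) && r x v)); last by move=> v; rewrite inE.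
by rewrite big_mkcondr; apply: leq_sum => v vS; case: (r x v).
Qed.
End Minors.

(** * Orientations of sparse graphs *)

Section Orientations.
Variable V : finType.
Implicit Types (r : rel V) (O : {set V * V}) (x y u v w : V).

(** Stated as a count, so that summing over a set turns [deg_sum] into in- and out-degrees. *)
Definition orients r O : Prop :=
  forall x y, r x y = ((x, y) \in O) + ((y, x) \in O) :> nat.

Definition outdeg O x : nat := \sum_y ((x, y) \in O).

Definition flip O v w : {set V * V} := (w, v) |: (O :\ (v, w)).

Lemma mem_flip O v w x y : ((x, y) \in flip O v w) =
  (x == w) && (y == v) || ~~ ((x == v) && (y == w)) && ((x, y) \in O).
Proof. by rewrite !inE. Qed.

Lemma orients_flip r O v w : irreflexive r -> orients r O -> (v, w) \in O ->
  orients r (flip O v w) /\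
  (forall x, outdeg (flip O v w) x + (x == v) = outdeg O x + (x == w)).
Proof.
move=> ir rO vwO.
have vw : v != w.
  by apply: contraTneq vwO => ->; have := rO w w; rewrite ir; case: (_ \in O).
have wvO : (w, v) \in O = false.
  by have := rO v w; rewrite vwO; case: (r v w); case: (_ \in O).
have wv : (w == v) = false by rewrite eq_sym (negPf vw).
split=> [x y|x]; first rewrite rO !mem_flip.
  have [->|xv] := eqVneq x v; have [->|yw] := eqVneq y w;
    rewrite ?eqxx ?(negPf vw) ?wv ?vwO ?wvO ?andbF ?andbT ?orbF //=.
  by have [->|xw] := eqVneq x w; have [->|yv] := eqVneq y v; rewrite /= ?vwO ?wvO.
have vB (a b : V) : \sum_y ((a == b) && (y == w)) = (a == b).
  by rewrite (bigD1 w) //= eqxx andbT big1 ?addn0 // => y /negPf->; rewrite andbF.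
have wB (a b : V) : \sum_y ((a == b) && (y == v)) = (a == b).
  by rewrite (bigD1 v) //= eqxx andbT big1 ?addn0 // => y /negPf->; rewrite andbF.
rewrite -(vB x v) -(wB x w) /outdeg -!big_split /=; apply: eq_bigr => y _.
rewrite mem_flip; have [->|xv] := eqVneq x v; have [->|yw] := eqVneq y w;
  rewrite ?eqxx ?(negPf vw) ?wv ?vwO ?wvO ?andbF ?andbT ?orbF //=.
by rewrite addn0; have [->|xw] := eqVneq x w; have [->|yv] := eqVneq y v; rewrite /= ?wvO ?addn0.
Qed.

(* Reversing the path p moves one unit of out-degree from v to its end. *)
Lemma move_excess r O v p : irreflexive r -> orients r O ->
  path (fun x y => (x, y) \in O) v p -> uniq (v :: p) ->
  exists2 O', orients r O' &
    forall x, outdeg O' x + (x == v) = outdeg O x + (x == last v p).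
Proof.
move=> ir; elim: p v O => [|w p IHp] v O rO; first by exists O.
move=> /= /andP[vwO pth] /andP[vp up].
have [rO1 d1] := orients_flip ir rO vwO.
(* By uniqueness the rest of the path avoids [v], so its arcs survive the flip. *)
have pth1 : path (fun x y => (x, y) \in flip O v w) w p.
  apply: (@sub_in_path _ (predC1 v) _ _ _ w p _ pth) => [x y xv yv xyO|].
    by rewrite mem_flip xyO (negPf xv) // orbT.
  by apply/allP => z zp /=; apply: contraNneq vp => <-.
have [O' rO' d'] := IHp w _ rO1 pth1 up.
by exists O' => // x; have := d1 x; have := d' x; lia.
Qed.

(** Induction on the total excess of the out-degrees over [d]. By sparsity, the set reachable from
    an overloaded vertex contains a vertex of out-degree below [d]; reversing a path to it lowers
    the excess. *)
Theorem bounded_orientation r d : symmetric r -> irreflexive r ->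
  (forall S, S != set0 -> deg_sum r S < d.*2 * #|S|) ->
  exists2 O, orients r O & forall x, outdeg O x <= d.
Proof.
move=> sr ir sparse.
have [O0 rO0] : exists O, orients r O.
  exists [set p | r p.1 p.2 && (enum_rank p.1 < enum_rank p.2)] => x y.
  rewrite !inE /= (sr y x); have [//|/= rxy|exy] := ltngtP (enum_rank x) (enum_rank y).
  - by rewrite andbT andbF addn0.
  - by rewrite andbF andbT.
  by move/ord_inj/enum_rank_inj: exy => ->; rewrite ir.
have [n] := ubnP (\sum_x (outdeg O0 x - d)).
elim: n O0 rO0 => // n IHn O rO lt_n.
have [/forallP|] := boolP [forall x, outdeg O x <= d]; first by exists O.
rewrite negb_forall => /existsP[v]; rewrite -ltnNge => dv.
pose eO : rel V := fun x y => (x, y) \in O.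
pose S := [set x | connect eO v x].
have vS : v \in S by rewrite inE connect0.
have [u uS du] : exists2 u, u \in S & outdeg O u < d.
  have S0 : S != set0 by apply/set0Pn; exists v.
  apply/exists_inP; apply: contraLR (sparse _ S0).
  rewrite negb_exists_in -leqNgt => /forall_inP geS.
  (* No arc leaves [S], so the out-degrees on [S] count exactly the edges inside [S]. *)
  have -> : deg_sum r S = (\sum_(x in S) outdeg O x).*2.
    have out_in : {in S, forall x, outdeg O x = \sum_(y in S) ((x, y) \in O)}.
      move=> x xS; rewrite /outdeg [RHS]big_mkcond; apply: eq_bigr => y _.
      case: ifPn => // /negPf yS; case: (boolP (_ \in O)) => // xyO.
      have: y \in S; last by rewrite yS.
      by rewrite inE; apply: connect_trans (connect1 xyO); move: xS; rewrite inE.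
    rewrite (eq_bigr _ out_in) -addnn {2}exchange_big -big_split /=.
    by apply: eq_bigr => x _; rewrite -big_split; apply: eq_bigr => y _; exact: rO.
  rewrite -doubleMl leq_double mulnC -sum_nat_const; apply: leq_sum => x xS.
  by rewrite leqNgt; apply: geS.
have [p pth lst] : exists2 p, path eO v p & u = last v p.
  by apply/connectP; move: uS; rewrite inE.
move: lst; case: (shortenP pth) => p' pth' up' _ lst.
have [O' rO' d'] := move_excess ir rO pth' up'.
apply: (IHn O') => //; move: lt_n; rewrite ltnS; apply: leq_trans.
have vu : v != u by apply: contraTneq du => <-; rewrite -leqNgt ltnW.
rewrite (bigD1 v) //= [X in _ < X](bigD1 v) //=.
have := d' v; rewrite -lst eqxx (negPf vu) => dv'.
suff: \sum_(x | x != v) (outdeg O' x - d) <= \sum_(x | x != v) (outdeg O x - d).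
  by move: dv; lia.
apply: leq_sum => x /negPf xv; have := d' x; rewrite xv -lst.
by case: eqP => [->|_]; lia.
Qed.
End Orientations.

(** * Teaching maps from orientations *)

Section Teaching.
Variable V : finType.
Implicit Types (e : rel V) (O : {set V * V}) (u v w : V) (C : {set {set V}}).

Lemma NCTD_le C (T : teaching_map V) : non_clashing C T -> NCTD C <= tm_size C T.
Proof.
rewrite /NCTD => ncT; have := mem_index_enum T.
elim: (index_enum _) => // T' r IHr; rewrite inE big_cons => /predU1P[<-|/IHr le_r].
  by rewrite ncT geq_minl.
by case: ifP => // _; apply: leq_trans le_r; apply: geq_minr.
Qed.

(** The default [v] occurs only when the two balls coincide, and then nothing has to be
    separated. *)
Definition separator e v u : V :=
  odflt v [pick w | distinguishes w (closed_nbhd e v) (closed_nbhd e u)].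

(** Several vertices may share a ball; [pick] fixes one center for each, and only arcs between
    chosen centers matter for non-clashing. *)
Definition arc_teaching_map e O : teaching_map V :=
  [ffun B => if [pick v | closed_nbhd e v == B] is Some v
             then v |: [set separator e v u | u in [set u | (v, u) \in O]]
             else set0].

Lemma separatorP e v u : closed_nbhd e v != closed_nbhd e u ->
  distinguishes (separator e v u) (closed_nbhd e v) (closed_nbhd e u).
Proof.
rewrite /separator; case: pickP => //= same; case/eqP.
by apply/setP => w; have /negbT := same w; rewrite negbK => /eqP.
Qed.

Lemma distinguishesC w (B B' : {set V}) : distinguishes w B B' = distinguishes w B' B.
Proof. by rewrite /distinguishes eq_sym. Qed.

Lemma arc_teaching_map_non_clashing e O : orients e O ->
  non_clashing (ball_family e) (arc_teaching_map e O).
Proof.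
move=> eO; apply/forall_inP => B BC; apply/forall_inP => B' BC'; apply/implyP => BB'.
rewrite !ffunE.
have center (D : {set V}) : D \in ball_family e ->
    exists2 v, closed_nbhd e v = D & [pick v | closed_nbhd e v == D] = Some v.
  case/imsetP => x _ ->; case: pickP => [v /eqP vx|/(_ x)]; last by rewrite eqxx.
  by exists v.
have [v vB ->] := center _ BC; have [v' vB' ->] := center _ BC'.
rewrite -{}vB -{}vB' in BB' *.
have vv' : v != v' by apply: contraNneq BB' => ->.
have := eO v v'; have [vv'O|nvv'O] := boolP ((v, v') \in O).
  move=> _; apply/existsP; exists (separator e v v'); rewrite separatorP // andbT.
  by apply/setUP; left; apply/setU1r/imset_f; rewrite inE.
have [v'vO|nv'vO] := boolP ((v', v) \in O).
  move=> _; apply/existsP; exists (separator e v' v).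
  rewrite distinguishesC separatorP 1?eq_sym // andbT.
  by apply/setUP; right; apply/setU1r/imset_f; rewrite inE.
have := eO v' v; rewrite (negPf nvv'O) (negPf nv'vO) => /eqP; rewrite eqb0 => /negPf nv'v _.
apply/existsP; exists v; rewrite /distinguishes !inE eqxx /=.
by rewrite nv'v (negPf vv').
Qed.

Lemma arc_teaching_map_size e O d : (forall v, outdeg O v <= d) ->
  tm_size (ball_family e) (arc_teaching_map e O) <= d.+1.
Proof.
move=> dO; apply/bigmax_leqP => B _; rewrite ffunE.
case: pickP => [v _|_]; last by rewrite cards0.
apply: leq_trans (leq_card_setU _ _) _; rewrite cards1 add1n ltnS.
apply: leq_trans (leq_imset_card _ _) (leq_trans _ (dO v)).
rewrite cardsE -sum1_card big_mkcond /=; apply: leq_sum => u _.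
by case: ifP => // uO; have -> : (v, u) \in O := uO.
Qed.
End Teaching.

Import Order.TTheory GRing.Theory Num.Theory.

(** * The van Kampen obstruction for K5 *)

Lemma xor_twice (T : eqType) (f : T -> bool) (s t : seq T) : perm_eq s (t ++ t) ->
  \big[addb/false]_(i <- s) f i = false.
Proof. by move=> st; rewrite (perm_big _ st) big_cat /= addbb. Qed.

Definition edges5 : seq (nat * nat) :=
  [seq p <- [seq (i, j) | i <- iota 0 5, j <- iota 0 5] | p.1 < p.2].

(** The 15 unordered pairs of independent edges of K5, each listed once: [i < k] fixes the order
    and, with [k < l], also excludes [i = l]. *)
Definition edge_pairs5 : seq (nat * nat * (nat * nat)) :=
  [seq d <- [seq (p, q) | p <- edges5, q <- edges5] |
    [&& d.1.1 < d.2.1, d.1.2 != d.2.1 & d.1.2 != d.2.2]].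

Lemma mem_edges5 i j : (i, j) \in edges5 -> i < j < 5.
Proof.
rewrite mem_filter => /andP[ij /allpairsP[[i' j'] [_ + [_ jE]]]].
by rewrite -jE mem_iota => j5; apply/andP.
Qed.

Lemma mem_edge_pairs5 i j k l : ((i, j), (k, l)) \in edge_pairs5 ->
  [/\ i < j < 5, k < l < 5, i < k, j != k & j != l].
Proof.
rewrite mem_filter => /andP[/and3P[ik jk jl] /allpairsP[[p q] [pE qE [pq ql]]]].
by split=> //; apply: mem_edges5; rewrite ?pq ?ql.
Qed.

(* The key (a, b, m) stands for the crossings of chain ab seen from point m if
   m < 5, and for the half-plane containing P b - P a if m = 5. *)
Definition pair_terms (d : nat * nat * (nat * nat)) : seq (nat * nat * nat) :=
  let: ((i, j), (k, l)) := d in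
  [:: (i, j, k); (i, j, l); (k, l, i); (k, l, j); (i, k, 5); (i, l, 5);
      (minn j k, maxn j k, 5); (minn j l, maxn j l, 5)].

(* Every key occurs an even number of times, while an odd number (5) of the pairs
   are interleaved, as are the crossing diagonals of a convex pentagon. *)
Lemma edge_pairs5_parity (f : nat * nat * nat -> bool) :
  {in edge_pairs5, forall d, \big[addb/false]_(i <- pair_terms d) f i
     = (d.2.1 < d.1.2) (+) (d.2.2 < d.1.2)} -> False.
Proof.
move=> fE.
have : \big[addb/false]_(d <- edge_pairs5) \big[addb/false]_(i <- pair_terms d) f i = true.
  by rewrite (eq_big_seq _ fE) unlock.
rewrite -(big_map pair_terms xpredT (fun t => \big[addb/false]_(i <- t) f i)) -big_flatten.
set L := flatten _.
(* Half of the copies of every key form a list whose double is a permutation of [L]; this is checked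
   by computation. *)
rewrite (@xor_twice _ f L (flatten [seq nseq (count_mem x L)./2 x | x <- undup L])) //.
Qed.

Section Crossings.
Local Open Scope ring_scope.
Variable R : realDomainType.
Local Notation point := (R * R)%type.
Implicit Types (a b u v w x y : point) (s t : seq point).

(** A half-open half-plane: exactly one of [u] and [- u] lies in it when [u] is nonzero, so points
    on the axis need no special treatment. *)
Definition upper u : bool := (0 < u.2) || (u.2 == 0) && (0 < u.1).

Definition acute u v : bool := 0 < u.1 * v.1 + u.2 * v.2.

(* For acute u v, whether the segment from u to v crosses the negative x-axis:
   when it crosses the x-axis at all, u.1 and v.1 are nonzero of the same sign. *)
Definition cross u v : bool := (upper u (+) upper v) && (u.1 < 0).

Lemma acute_neq0 u v : acute u v -> u != 0.
Proof. by apply: contraTneq => ->; rewrite /acute /= !mul0r addr0 ltxx. Qed.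

Lemma acuteC u v : acute u v = acute v u.
Proof. by rewrite /acute mulrC [u.2 * _]mulrC. Qed.

Lemma upperN u : u != 0 -> upper (- u) = ~~ upper u.
Proof.
case: u => p q; rewrite -pair_eqE /upper /= !oppr_gt0 oppr_eq0.
by case: (ltgtP q 0) => //= _; rewrite andbT; case: (ltgtP p 0).
Qed.

(** The second coordinates have weakly opposite signs, so the positive part of the inner product
    must come from the first ones. *)
Lemma upper_switch u v : acute u v -> upper u != upper v -> 0 < u.1 * v.1.
Proof.
rewrite /acute /upper.
case: (ltgtP u.2 0) => [hu|hu|hu]; case: (ltgtP v.2 0) => [hv|hv|hv] //= uv _; nra.
Qed.

Lemma cross_sign u v : acute u v ->
  (upper u != upper v) ==> ((u.1 < 0) == (v.1 < 0)).
Proof.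
move=> uv; apply/implyP => /(upper_switch uv) {}uv.
by case: (ltrP u.1 0) uv => hu; case: (ltrP v.1 0) => hv // ?; exfalso; nra.
Qed.

(** Pairwise acute vectors do not wind around the origin. By [cross_sign] a change of half-plane
    preserves the sign of the first coordinate, and the rest is Boolean. *)
Lemma cross_triangle u v w : acute u v -> acute v w -> acute u w ->
  cross u v (+) cross v w = cross u w.
Proof.
move=> /cross_sign uv /cross_sign vw /cross_sign uw; rewrite /cross.
move: uv vw uw; case: (upper u); case: (upper v); case: (upper w);
  by case: (u.1 < 0); case: (v.1 < 0); case: (w.1 < 0).
Qed.

(** Negation exchanges the negative and the positive x-axis, and crossings of the two together are
    the changes of half-plane. *)
Lemma crossN u v : acute u v ->
  cross (- u) (- v) = cross u v (+) (upper u (+) upper v).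
Proof.
move=> uv; have vu := uv; rewrite acuteC in vu.
rewrite /cross !upperN ?(acute_neq0 uv) ?(acute_neq0 vu) //= oppr_lt0.
move: (upper_switch uv); case: (upper u); case: (upper v) => //= /(_ isT) {}uv.
  by case: (ltgtP u.1 0) uv => //= ->; rewrite mul0r ltxx.
by case: (ltgtP u.1 0) uv => //= ->; rewrite mul0r ltxx.
Qed.

(** A mod 2 count of how often the chain [a :: s] crosses the leftward ray from [x]. *)
Fixpoint crossings x a s : bool :=
  if s is b :: s' then cross (a - x) (b - x) (+) crossings x b s' else false.

Section Grid.
Variables (close : rel point) (X Y : point -> Prop).
Hypothesis close_refl : reflexive close.
Hypothesis close_sym : symmetric close.
Hypothesis sep : forall u u' x x', X u -> X u' -> Y x -> Y x' ->
  close u u' -> close x x' -> acute (u - x) (u' - x').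

(** Each cell of the strip is cut by the diagonal from [a - x] to [b - y] into two acute triangles;
    sides shared by neighbouring cells cancel. *)
Lemma crossings_shift x y a s : Y x -> Y y -> close x y ->
  {in a :: s, forall u, X u} -> path close a s ->
  crossings x a s (+) crossings y a s =
    cross (a - x) (a - y) (+) cross (last a s - x) (last a s - y).
Proof.
move=> Yx Yy xy; elim: s a => [|b s IHs] a Xs /=; first by rewrite addbb.
case/andP=> ab pth.
have Xa : X a by apply: Xs; rewrite mem_head.
have Xs' : {in b :: s, forall u, X u} by move=> u us; apply: Xs; rewrite inE us orbT.
have Xb : X b by apply: Xs'; rewrite mem_head.
have yx : close y x by rewrite close_sym.
have T1 : cross (a - x) (b - x) (+) cross (b - x) (b - y) = cross (a - x) (b - y).
  by apply: cross_triangle; apply: sep.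
have T2 : cross (a - x) (a - y) (+) cross (a - y) (b - y) = cross (a - x) (b - y).
  by apply: cross_triangle; apply: sep.
move: (IHs b Xs' pth) T1 T2.
by do 7![case: (cross _ _)]; case: (crossings _ _ _); case: (crossings _ _ _).
Qed.

(* The crossings around the boundary of the grid s x t cancel; negating the
   difference vectors on two of its sides produces the half-plane terms. *)
Lemma crossings_grid a s b t :
  {in a :: s, forall u, X u} -> path close a s ->
  {in b :: t, forall u, Y u} -> path close b t ->
  crossings b a s (+) crossings (last b t) a s (+)
    (crossings a b t (+) crossings (last a s) b t) =
  upper (b - a) (+) upper (last b t - a) (+)
    (upper (b - last a s) (+) upper (last b t - last a s)).
Proof.
move=> Xs ps; elim: t b => [|y t IHt] b Ys /=; first by rewrite !addbb.
case/andP=> yb pt.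
have Yb : Y b by apply: Ys; rewrite mem_head.
have Ys' : {in y :: t, forall u, Y u} by move=> u us; apply: Ys; rewrite inE us orbT.
have Yy : Y y by apply: Ys'; rewrite mem_head.
have Xa : X a by apply: Xs; rewrite mem_head.
have Xl : X (last a s) by apply: Xs; apply: mem_last.
have N u : X u -> cross (u - b) (u - y) =
    cross (b - u) (y - u) (+) (upper (b - u) (+) upper (y - u)).
  move=> Xu; rewrite -crossN ?opprB // /acute /= -mulrNN -[X in _ + X]mulrNN !opprB.
  exact: sep.
move: (IHt y Ys' pt) (crossings_shift Yb Yy yb Xs ps); rewrite !N //.
move=> + /(canRL (addbK _)) ->.
move: (crossings y a s) (crossings (last y t) a s) (crossings a y t).
move: (crossings (last a s) y t) (cross (b - a) _) (cross (b - last a s) _).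
move: (upper (b - a)) (upper (y - a)) (upper (b - last a s)) (upper (y - last a s)).
move: (upper (last y t - a)) (upper (last y t - last a s)); clear.
by do 12!case.
Qed.
End Grid.

(** For each pair of independent edges, [crossings_grid] supplies the equation that
    [edge_pairs5_parity] refutes. *)
Theorem van_kampen_chains (close : rel point) (P : nat -> point)
    (s : nat -> nat -> seq point) (X : nat -> nat -> point -> Prop) :
  reflexive close -> symmetric close ->
  (forall i j, (i < j < 5)%N -> [/\ path close (P i) (s i j),
     last (P i) (s i j) = P j & {in P i :: s i j, forall u, X i j u}]) ->
  (forall i j k l, (i < j < 5)%N -> (k < l < 5)%N -> i != k -> i != l -> j != k -> j != l ->
     forall u u' x x', X i j u -> X i j u' -> X k l x -> X k l x' ->
     close u u' -> close x x' -> acute (u - x)%R (u' - x')%R) ->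
  False.
Proof.
move=> cr cs chain sep.
refine (@edge_pairs5_parity (fun key => let: (i, j, m) := key in
  if (m < 5)%N then crossings (P m) (P i) (s i j) else upper (P j - P i)%R) _).
case=> [[i j] [k l]] /mem_edge_pairs5[ij5 kl5 ik jk jl].
have /andP[ij j5] := ij5; have /andP[kl l5] := kl5.
have [i5 k5] : (i < 5)%N /\ (k < 5)%N by rewrite (ltn_trans ij j5) (ltn_trans kl l5).
have il : (i < l)%N by apply: ltn_trans ik kl.
have [pij eij Xij] := chain _ _ ij5; have [pkl ekl Xkl] := chain _ _ kl5.
have sepd := sep i j k l ij5 kl5 (negbT (ltn_eqF ik)) (negbT (ltn_eqF il)) jk jl.
have := crossings_grid cr cs sepd Xij pij Xkl pkl; rewrite eij ekl.
have Xi : X i j (P i) by apply: Xij; rewrite mem_head.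
have Xj : X i j (P j) by apply: Xij; rewrite -eij mem_last.
have Xk : X k l (P k) by apply: Xkl; rewrite mem_head.
have Xl : X k l (P l) by apply: Xkl; rewrite -ekl mem_last.
(* Sorting the two indices negates the vector exactly when [m < j]; these corrections, for [k] and
   [l], form the interleaving bit. *)
have swap m : X k l (P m) -> m != j ->
    upper (P (maxn j m) - P (minn j m)) = upper (P m - P j) (+) (m < j)%N.
  move=> Xm mj; case: (ssrnat.ltngtP m j) mj => //= mj _; last by rewrite addbF.
  rewrite -opprB upperN ?addbT // -opprB oppr_eq0.
  by apply: (@acute_neq0 _ (P j - P m)); apply: sepd.
rewrite unlock /= i5 j5 k5 l5 !swap // 1?eq_sym //.
move=> /(canRL (addbK _)) /(canRL (addbK _)) ->.
move: (crossings (P l) _ _) (crossings (P i) _ _) (crossings (P j) _ _).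
move: (upper (P k - P i)) (upper (P l - P i)) (upper (P k - P j)) (upper (P l - P j)).
by move: (k < j)%N (l < j)%N; clear; do 9!case.
Qed.
End Crossings.

From mathcomp Require Import all_classical all_reals all_analysis.
From mathcomp Require Import Rstruct Rstruct_topology.
Import numFieldNormedType.Exports.

(** * Chains in planar drawings *)

Section Topology.
Local Open Scope ring_scope.
Local Open Scope classical_set_scope.
Variable R : realType.

Definition within_dist (T : normedModType R) (d : R) : rel T :=
  fun u v => `|u - v| < d.

Definition chained (T : normedModType R) (d : R) (X : set T) (a b : T) : Prop :=
  exists s, [/\ path (within_dist d) a s, last a s = b & {in a :: s, forall u, X u}].

Lemma chained_trans (T : normedModType R) (d : R) (X : set T) a b c :
  chained d X a b -> chained d X b c -> chained d X a c.
Proof.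
move=> [s [ps ls Xs]] [t [pt lt Xt]]; exists (s ++ t).
split; rewrite ?cat_path ?last_cat ?ls ?ps //.
move=> u; rewrite -cat_cons mem_cat => /orP[/Xs//|ut].
by apply: Xt; rewrite inE ut orbT.
Qed.

Lemma chained_sub (T : normedModType R) (d : R) (X Y : set T) a b :
  X `<=` Y -> chained d X a b -> chained d Y a b.
Proof. by move=> XY [s [ps ls Xs]]; exists s; split=> // u /Xs/XY. Qed.

(** The points of [K] reachable by chains form a relatively open and closed set: both they and the
    unreachable ones are cut out by unions of [d]-balls. *)
Lemma connected_chained (T : normedModType R) (d : R) (K : set T) a b :
  0 < d -> connected K -> K a -> K b -> chained d K a b.
Proof.
move=> d0 cK Ka Kb; pose B := [set u | K u /\ chained d K a u].
suff BK : B = K by have [_] : B b by rewrite BK.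
have step u v : B u -> K v -> `|u - v| < d -> B v.
  move=> [Ku au] Kv uv; split=> //; apply: chained_trans au _.
  exists [:: v]; split=> //=; first by rewrite /within_dist uv.
  by move=> w; rewrite !inE => /orP[|] /eqP->.
apply: cK.
- by exists a; split=> //; exists [::]; split=> // u; rewrite inE => /eqP->.
- exists (\bigcup_(u in B) ball u d).
    by apply: bigcup_open => u _; exact: ball_open.
  apply/seteqP; split=> [u Bu|v [Kv [u Bu]]].
    by split; [case: Bu | exists u => //; exact: ballxx].
  by rewrite -ball_normE /= => /(step _ _ Bu Kv).
- exists (~` \bigcup_(u in K `\` B) ball u d).
    apply: open_closedC; apply: bigcup_open => u _; exact: ball_open.
  apply/seteqP; split=> [v Bv|v [Kv nv]].
    split; first by case: Bv.
    move=> [u [Ku nBu]]; rewrite -ball_normE /= distrC => uv; apply: nBu.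
    exact: step Bv Ku uv.
  by apply: contrapT => nBv; apply: nv; exists v => //; exact: ballxx.
Qed.

(** The distance attains its minimum on the compact product, and disjointness makes that minimum
    positive. *)
Lemma compact_disjoint_dist (T : normedModType R) (K L : set T) :
  compact K -> compact L -> K `&` L = set0 ->
  exists2 d : R, 0 < d & forall u v, K u -> L v -> d <= `|u - v|.
Proof.
move=> cK cL KL.
have [KL0|/set0P KL0] := eqVneq (K `*` L) set0.
  exists 1 => // u v Ku Lv; have : (K `*` L) (u, v) by [].
  by rewrite KL0.
have cf : continuous (fun z : T * T => `|z.1 - z.2|).
  by move=> z; apply: cvg_norm; apply: cvgB; [exact: cvg_fst | exact: cvg_snd].
have cf' : {within K `*` L, continuous (fun z : T * T => `|z.1 - z.2|)}.
  exact: continuous_subspaceT.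
have [[u v] /set_mem[/= Ku Lv] minuv] := compact_EVT_min KL0 (compact_setX cK cL) cf'.
exists `|u - v|; last by move=> u' v' Ku' Lv'; by apply: (minuv (u', v')); apply: mem_set.
rewrite normr_gt0 subr_eq0; apply/eqP => uv.
have : (K `&` L) u by split; [exact: Ku | rewrite uv; exact: Lv].
by rewrite KL.
Qed.

(** Here [p * p'] is at least [d ^+ 2 / 2], while [q * q'], being [((q + q') / 2) ^+ 2 - ((q - q') /
    2) ^+ 2], is at least [- d ^+ 2 / 16]. *)
Lemma dot_pos (d p q p' q' : R) : 0 < d -> d <= p ->
  p - p' < d / 2 -> - (d / 2) < q - q' < d / 2 -> 0 < p * p' + q * q'.
Proof.
move=> d0 dp pp' /andP[q1 q2].
have h1 : d * (d / 2) <= p * p' by apply: ler_pM => //; lra.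
have h2 : (q - q') ^+ 2 <= (d / 2) ^+ 2 by nra.
have h3 : 0 <= (q - (q - q') / 2) ^+ 2 by exact: sqr_ge0.
nra.
Qed.

(** In the max norm some coordinate of [u - x] has absolute value at least [d], and two moves below
    [d / 4] change each coordinate by less than [d / 2]. The four cases are the choice of coordinate
    and sign. *)
Lemma acute_close (d : R) (u u' x x' : R * R) :
  d <= `|u - x| -> `|u - u'| < d / 4 -> `|x - x'| < d / 4 ->
  acute (u - x) (u' - x').
Proof.
have normE (z : R * R) : `|z| = Num.max `|z.1| `|z.2| by [].
rewrite !normE /acute /=.
case: u u' x x' => [u1 u2] [u1' u2'] [x1 x2] [x1' x2'] /=.
rewrite le_max !gt_max !ltr_norml !ler_normr.
move=> H /andP[/andP[a1 a2] /andP[b1 b2]] /andP[/andP[c1 c2] /andP[d1 d2]].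
have d0 : 0 < d by lra.
move: H => /orP[/orP[]|/orP[]] H.
- by apply: (dot_pos d0 H); lra.
- rewrite -mulrNN; apply: (dot_pos d0 H); lra.
- by rewrite addrC; apply: (dot_pos d0 H); lra.
- rewrite addrC -mulrNN; apply: (dot_pos d0 H); lra.
Qed.

Lemma finite_pos_bound (I : finType) (P : I -> R -> Prop) :
  (forall i, exists2 d : R, 0 < d & P i d) ->
  (forall i d d', 0 < d' -> d' <= d -> P i d -> P i d') ->
  exists2 d : R, 0 < d & forall i, P i d.
Proof.
move=> exP mono.
have /choice[f fP] : forall i, exists d : R, 0 < d /\ P i d.
  by move=> i; have [d d0 Pd] := exP i; exists d.
have m0 : 0 < \big[Num.min/1]_i f i by apply: lt_bigmin => // i _; case: (fP i).
exists (\big[Num.min/1]_i f i) => // i; apply: (mono _ (f i)) => //; last by case: (fP i).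
exact: bigmin_le.
Qed.
End Topology.

(** * Excluding a K5 minor from a drawing *)

Section Planarity.
Local Open Scope ring_scope.
Local Open Scope classical_set_scope.
Variable R : realType.

Lemma connect_chained (V : finType) (e : rel V) (A : {set V}) (d : R)
    (p : V -> R * R) (K : V -> V -> set (R * R)) x y :
  (forall u v, e u v -> chained d (K u v) (p u) (p v)) ->
  x != y -> connect (rel_in e A) x y ->
  chained d [set z | exists u v, [/\ u \in A, v \in A, e u v & K u v z]] (p x) (p y).
Proof.
move=> chK xy /connectP[q pth yE]; subst y.
(* The hypothesis [x != y] rules out the empty path, where no edge would put [p x] into the target
   set. *)
case: q pth xy => [|w q] pth xy; first by rewrite eqxx in xy.
elim: q x w pth {xy} => [|w' q IHq] x w; cbn [path last] => /andP[/and3P[xA wA xw] pth].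
  apply: chained_sub (chK _ _ xw) => z Kz; by exists x, w.
have cw : chained d [set z | exists u v, [/\ u \in A, v \in A, e u v & K u v z]] (p x) (p w).
  apply: chained_sub (chK _ _ xw) => z Kz; by exists x, w.
exact: chained_trans cw (IHq w w' pth).
Qed.

(** Arcs of independent edges are disjoint compact sets, hence at least some common [d] apart.
    Chains of step [d / 4] along the arcs inside unions of two branch sets then contradict
    [van_kampen_chains]. *)
Theorem drawing_no_K5_minor (V : finType) (e : rel V) (S : {set V})
    (p : V -> R * R) (arc : V -> V -> R -> R * R) :
  symmetric e ->
  injective p ->
  (forall x y, e x y ->
    [/\ {within `[0, 1], continuous (arc x y)}, set_inj `[0, 1] (arc x y),
        arc x y 0 = p x & arc x y 1 = p y]) ->
  (forall x y z t, e x y -> 0 < t < 1 -> arc x y t <> p z) ->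
  (forall x y x' y' s t, e x y -> e x' y' -> 0 < s < 1 -> 0 < t < 1 ->
     arc x y s = arc x' y' t ->
     ((x == x') && (y == y')) || ((x == y') && (y == x'))) ->
  ~ clique_minor e S 5.
Proof.
move=> se injp arcP arc_vertex arc_arc [Bs [sz _ con lnk]].
pose K x y : set (R * R) := arc x y @` `[0, 1].
have K_disj x y x' y' : e x y -> e x' y' -> x != x' -> x != y' -> y != x' -> y != y' ->
    K x y `&` K x' y' = set0.
  move=> exy exy' xx' xy' yx' yy'.
  have [_ _ a0 a1] := arcP _ _ exy; have [_ _ a0' a1'] := arcP _ _ exy'.
  have inI (t : R) : `[0, 1] t -> [\/ t = 0, t = 1 | 0 < t < 1].
    rewrite /= in_itv /= !le_eqVlt => /andP[/orP[/eqP<-|t0] /orP[/eqP->|t1]].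
    - exact: Or31.
    - exact: Or31.
    - exact: Or32.
    - by apply: Or33; rewrite t0.
  apply/seteqP; split=> // z [[t /inI tI <-] [t' /inI tI' tt']].
  have ep (q : R) a b : e a b -> q = 0 \/ q = 1 -> exists2 v, arc a b q = p v & v = a \/ v = b.
    move=> eab; have [_ _ b0 b1] := arcP _ _ eab.
    by case=> ->; [exists a => //; left | exists b => //; right].
  have nv v v' : p v = p v' -> v = x \/ v = y -> v' = x' \/ v' = y' -> False.
    move=> /injp->; case=> ->; case=> /eqP; exact/negP.
  have tE : (t = 0 \/ t = 1) \/ 0 < t < 1 by case: tI; tauto.
  have tE' : (t' = 0 \/ t' = 1) \/ 0 < t' < 1 by case: tI'; tauto.
  (* Two ends meet only at a common vertex, an end and an interior point never, and two interior
     points only on the same edge. *)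
  case: tE => [/(ep _ _ _ exy)[v av vxy]|t01]; case: tE' => [/(ep _ _ _ exy')[v' av' vxy']|t01'].
  - by apply: (nv v v') => //; rewrite -av -av'.
  - by apply: (arc_vertex _ _ v _ exy' t01'); rewrite tt'.
  - by apply: (arc_vertex _ _ v' _ exy t01); rewrite -tt'.
  by have := arc_arc _ _ _ _ _ _ exy exy' t01 t01' (esym tt'); rewrite (negPf xx') (negPf xy').
have [d d0 dP] : exists2 d : R, 0 < d & forall q : (V * V) * (V * V),
    let: ((x, y), (x', y')) := q in
    e x y -> e x' y' -> x != x' -> x != y' -> y != x' -> y != y' ->
    forall u v, K x y u -> K x' y' v -> d <= `|u - v|.
  apply: finite_pos_bound => [[[x y] [x' y']]|[[x y] [x' y']] d d' d0 dd' H]; last first.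
    by move=> *; apply: le_trans dd' _; apply: H.
  have [/and5P[exy exy' xx' xy' /andP[yx' yy']]|no] :=
    boolP [&& e x y, e x' y', x != x', x != y', y != x' & y != y']; last first.
    by exists 1 => // exy exy' xx' xy' yx' yy'; rewrite exy exy' xx' xy' yx' yy' in no.
  have cK a b : e a b -> compact (K a b).
    by case/arcP => cab _ _ _; apply: continuous_compact => //; exact: segment_compact.
  have [d d0 dP] := compact_disjoint_dist (cK _ _ exy) (cK _ _ exy')
    (K_disj _ _ _ _ exy exy' xx' xy' yx' yy').
  by exists d => // *; exact: dP.
have d4 : 0 < d / 4 by lra.
have chK x y : e x y -> chained (d / 4) (K x y) (p x) (p y).
  move=> exy; have [cxy _ a0 a1] := arcP _ _ exy.
  apply: connected_chained => //.
  - by apply: connected_continuous_connected => //; exact: segment_connected.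
  - by exists 0; rewrite //= in_itv /= lexx ler01.
  - by exists 1; rewrite //= in_itv /= lexx ler01.
pose B i := nth finset.set0 Bs i.
have conB i : (i < 5)%N -> connected_in e (B i).
  by move=> i5; apply: (allP con); rewrite mem_nth ?sz.
have lnkB i j : (i < j < 5)%N -> linked e (B i) (B j).
  by move=> /andP[ij j5]; apply: (pairwiseP _ lnk); rewrite ?inE ?sz // (ltn_trans ij).
(* Indices range over all of [nat], so a default vertex is needed; it is taken from the nonempty
   [B 0]. *)
have /choice[c cB] : forall i, exists x, (i < 5)%N -> x \in B i.
  have [x0 _] : exists x, x \in B 0.
    by have /connected_inP[/finset.set0Pn] := conB 0 isT.
  move=> i; have [i5|] := boolP (i < 5)%N; last by exists x0.
  by have /connected_inP[/finset.set0Pn[x xB] _] := conB i i5; exists x.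
(* For independent [ij] and [kl] the unions of branch sets are disjoint, so any two edges used here
   share no endpoint and [dP] applies. *)
pose X i j : set (R * R) :=
  [set z | exists u v, [/\ u \in B i :|: B j, v \in B i :|: B j, e u v & K u v z]].
have chX i j : (i < j < 5)%N -> chained (d / 4) (X i j) (p (c i)) (p (c j)).
  move=> ij; have /andP[ij' j5] := ij; have i5 := ltn_trans ij' j5.
  have [dij _] := linkedP _ _ _ (lnkB _ _ ij).
  apply: connect_chained => //.
    by apply: contraTneq (cB _ i5) => ->; rewrite (disjointFl dij (cB _ j5)).
  have /connected_inP[_] := connected_in_setU se (conB _ i5) (conB _ j5) (lnkB _ _ ij).
  by apply; rewrite inE cB ?orbT.
have /choice[s sP] : forall ij : nat * nat, exists s : seq (R * R), (ij.1 < ij.2 < 5)%N ->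
   [/\ path (@within_dist R _ (d / 4)) (p (c ij.1)) s, last (p (c ij.1)) s = p (c ij.2)
     & {in p (c ij.1) :: s, forall u, X ij.1 ij.2 u}].
  case=> i j /=.
  have [ij|] := boolP (i < j < 5)%N; last by exists [::].
  by have [s sP] := chX _ _ ij; exists s.
have BB i j k : (i < 5)%N -> (j < 5)%N -> i != j -> k \in B i -> k \in B j -> False.
  move=> i5 j5; rewrite ssrnat.neq_ltn => /orP[ij|ji] ki kj.
    have ij5 : (i < j < 5)%N by rewrite ij.
    have [dij _] := linkedP _ _ _ (lnkB _ _ ij5).
    by rewrite (disjointFr dij ki) in kj.
  have ji5 : (j < i < 5)%N by rewrite ji.
  have [dji _] := linkedP _ _ _ (lnkB _ _ ji5).
  by rewrite (disjointFr dji kj) in ki.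
apply: (@van_kampen_chains R (@within_dist R _ (d / 4)) (p \o c) (fun i j => s (i, j)) X).
- by move=> u; rewrite /within_dist subrr normr0.
- by move=> u v; rewrite /within_dist distrC.
- by move=> i j ij; have := sP (i, j) ij.
move=> i j k l /andP[ij j5] /andP[kl l5] ik il jk jl u u' x x' Xu _ Xx _ uu' xx'.
have i5 := ltn_trans ij j5; have k5 := ltn_trans kl l5.
apply: acute_close uu' xx'.
have [a [b [aB bB eab Ku]]] := Xu; have [a' [b' [aB' bB' eab' Kx]]] := Xx.
have sepB y z : y \in B i :|: B j -> z \in B k :|: B l -> y != z.
  move=> yB zB; apply/eqP => yz; rewrite -{z}yz in zB; move: yB zB.
  move=> /finset.setUP[yB|yB] /finset.setUP[zB|zB].
  - exact: (BB i k y).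
  - exact: (BB i l y).
  - exact: (BB j k y).
  - exact: (BB j l y).
by apply: (dP ((a, b), (a', b'))) => //; apply: sepB.
Qed.
End Planarity.

Theorem theorem7 (V : finType) (e : rel V) :
  simple_graph e -> planar e -> NCTD (ball_family e) <= 5.
Proof.
move=> [se ie] [p [arc [injp arcP arc_vertex arc_arc]]].
have [S S0|O eO dO] := bounded_orientation (d := 4) se ie.
  rewrite ltnNge; apply/negP => dense.
  (* Failure of sparsity for [d = 4] is the density bound for [k = 3], as [4.*2 = 2 ^ 3]. *)
  have := dense_clique_minor (k := 3) se ie S0 dense.
  exact: (@drawing_no_K5_minor Rdefinitions.R V e S p arc se injp arcP arc_vertex arc_arc).
apply: leq_trans (NCTD_le (arc_teaching_map_non_clashing eO)) _.
exact: arc_teaching_map_size dO.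
Qed.
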